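(* Let $D$, $D_n$, $B_n$ and $B_{1,1}$ be as defined in the context, and write $x^*=\min\{x,1-x\}$. Then: (i) For every $x\in D$ the limit $\lim_{n\to\infty}B_n(x)$ exists; denote it by $P(x)$. (ii) The function $P:D\to[0,\infty)$ is the pointwise maximal function on $D$ with $P(0)=P(1)=0$ satisfying the two-point inequality with $(\alpha,\beta)=(1,1)$: namely, $P(0)=P(1)=0$, \[ P\Big(\frac{x+y}{2}\Big)\le\frac{P(x)+P(y)}{2}+\Big|\frac{x-y}{2}\Big|\qquad\text{for all }x,y\in D, \] and every $Q:D\to[0,\infty)$ with $Q(0)=Q(1)=0$ satisfying the same inequality for all $x,y\in D$ satisfies $Q(x)\le P(x)$ for all $x\in D$. (iii) There exists a universal constant $C>0$ such that \[ |P(x)-P(y)|\le C|x-y|\log\Big(\frac{1}{|x-y|}\Big) \] for all $x,y\in D$ with $|x-y|<\frac12$. (iv) For all $x\in D$ we have $P(x)=P(1-x)$ and $P(x)+x=2P(x/2)$. (v) For all $x\in D$ we have \[ P(x)\ge x^*\log_2(1/x^* ), \] with equality at the points $x=2^{-k}$ and $x=1-2^{-k}$ for all nonnegative integers $k$. (vi) We have $B_{1,1}|_D=P$, and $B_{1,1}$ satisfies (iii)–(v) on all of $[0,1]$: that is, with $P$ replaced by $B_{1,1}$ and $D$ replaced by $[0,1]$, the statements (iii), (iv), (v) hold.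
   Context: For an integer $n\ge0$, $D_n=\{k/2^n: k=0,1,\dots,2^n\}$, and $D=\bigcup_{n\ge0}D_n$ (dyadic rationals in $[0,1]$). For an integer $j\ge0$, $s(j)$ is the number of $1$'s in the binary representation of $j$. For an integer $k\ge 0$, $F(k)=\sum_{j=0}^{k-1}s(j)$, with $F(0)=0$. Define $B_n:D_n\to[0,\infty)$ by \[ B_n(x)=nx-\frac{1}{2^{n-1}}F(2^n x). \] (For $x\in D$, $B_n(x)$ is defined for all sufficiently large $n$.) $B_{1,1}$ is the pointwise maximal function (it exists) in the family $\mathcal{F}_{1,1}$ of all non-negative continuous functions $f$ on $[0,1]$ with $f(0)=f(1)=0$ and $f\big(\frac{x+y}{2}\big)\le\frac{f(x)+f(y)}{2}+\big|\frac{x-y}{2}\big|$ for all $x,y\in[0,1]$; that is, $B_{1,1}(t)=\sup\{f(t): f\in\mathcal{F}_{1,1}\}$. Convention: $0\log(1/0)=0$ for any base of logarithm. *)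

(* Defs.v *)
From mathcomp Require Import all_boot all_order all_algebra.
From mathcomp Require Import all_classical all_reals all_analysis.
From mathcomp Require Import lra.
Set Implicit Arguments.
Unset Strict Implicit.
Unset Printing Implicit Defensive.
Import Order.TTheory GRing.Theory Num.Theory.
Import numFieldNormedType.Exports.
Local Open Scope classical_set_scope.
Local Open Scope ring_scope.

(* The i-th binary digit of j is [odd (j %/ 2 ^ i)]; it vanishes for i >= j
   because j < 2 ^ j. *)
Definition s (j : nat) : nat := (\sum_(i < j) odd (j %/ 2 ^ i))%N.

Definition F (k : nat) : nat := (\sum_(j < k) s j)%N.

Section Bellman.
Context {R : realType}.
Implicit Types (x y t : R) (f : R -> R) (S : set R).

Definition Dn (n : nat) : set R :=
  [set x | exists2 k : nat, (k <= 2 ^ n)%N & x = k%:R / 2 ^+ n].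

Definition D : set R := \bigcup_n Dn n.

(* Meaningful for x in Dn n only: there 2 ^+ n * x is a natural number, and
   [Num.truncn] recovers it (lemma [B_Dn]). The exponent n - 1 is an integer,
   so that n = 0 gives 2 ^ (-1). *)
Definition B (n : nat) (x : R) : R :=
  n%:R * x - 1 / 2 ^ (n%:Z - 1) * (F (Num.truncn (2 ^+ n * x)))%:R.

Lemma B_Dn (n k : nat) :
  B n (k%:R / 2 ^+ n) =
  n%:R * (k%:R / 2 ^+ n) - 1 / 2 ^ (n%:Z - 1) * (F k)%:R.
Proof. by rewrite /B [2 ^+ n * _]mulrC divfK ?expf_neq0// natrK. Qed.

(* For x in D, finitely many terms B n x (those with x not in Dn n) are junk;
   they do not affect the limit. *)
Definition P (x : R) : R := limn (fun n => B n x).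

Definition two_point_inequality S f : Prop :=
  forall x y, S x -> S y ->
    f ((x + y) / 2) <= (f x + f y) / 2 + `|(x - y) / 2|.

(* Functions on [0, 1] are represented by total functions, constrained on
   [0, 1] only. *)
Definition F11 : set (R -> R) :=
  [set f : R -> R | [/\ {within `[0, 1], continuous f},
               forall x : R, x \in `[0, 1] -> 0 <= f x,
               f 0 = 0, f 1 = 0 &
               two_point_inequality `[0, 1] f]].

Definition B11 (t : R) : R := sup [set f t | f in F11].

(* The real-valued [sup] is a default value on unbounded sets; on [0, 1] it is
   a genuine supremum. *)
Lemma F11_has_sup t : t \in `[0, 1] -> has_sup [set f t | f in F11].
Proof.
move=> t01; split.
  exists 0; exists (fun=> 0) => //; split => //.
  by move=> x; exact: cvg_cst.
exists 1; move=> _ [f [fc f0 f00 f10 fm] <-].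
have [c c01 cmax] := EVT_max ler01 fc.
apply: (le_trans (cmax t t01)).
move: (c01); rewrite in_itv /= => /andP[c0 c1].
have [c2|c2] := leP c (1 / 2).
- have m0 : `[0, 1]%classic (0 : R) by rewrite /= in_itv /= lexx ler01.
  have mc : (c + c) \in `[0, 1] by rewrite in_itv /=; apply/andP; split; lra.
  have := fm 0 (c + c) m0 mc.
  have -> : (0 + (c + c)) / 2 = c by lra.
  have -> : (0 - (c + c)) / 2 = - c by lra.
  rewrite normrN ger0_norm// f00.
  have := cmax _ mc; lra.
- have m1 : `[0, 1]%classic (1 : R) by rewrite /= in_itv /= lexx ler01.
  have mc : (c + c - 1) \in `[0, 1] by rewrite in_itv /=; apply/andP; split; lra.
  have := fm 1 (c + c - 1) m1 mc.
  have -> : (1 + (c + c - 1)) / 2 = c by lra.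
  have -> : (1 - (c + c - 1)) / 2 = 1 - c by lra.
  rewrite ger0_norm ?subr_ge0// f10.
  have := cmax _ mc; lra.
Qed.

Definition star (x : R) : R := Num.min x (1 - x).

Definition log2 (x : R) : R := ln x / ln 2.

(* In the next definitions the convention 0 log (1/0) = 0 holds because of the
   factor 0. *)
Definition log_Lipschitz S f : Prop :=
  exists2 C : R, 0 < C &
    forall x y, S x -> S y -> `|x - y| < 1 / 2 ->
      `|f x - f y| <= C * `|x - y| * ln (1 / `|x - y|).

Definition functional_equations S f : Prop :=
  forall x, S x -> f x = f (1 - x) /\ f x + x = 2 * f (x / 2).

Definition entropy_bound S f : Prop :=
  (forall x, S x -> star x * log2 (1 / star x) <= f x) /\
  (forall (k : nat) x, x = 2 ^- k \/ x = 1 - 2 ^- k ->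
     f x = star x * log2 (1 / star x)).

(* Functions on D are represented by total functions, constrained on D only. *)
Definition admissible_on_D f : Prop :=
  [/\ forall x, D x -> 0 <= f x,
      f 0 = 0, f 1 = 0 & two_point_inequality D f].

End Bellman.

(* Main.v *)
(* On the dyadic point k / 2^n the sequence B_m is constant for m >= n, so that
   P (k / 2^n) = (n k - 2 F k) / 2^n. The superadditivity
   F k + F l + min k l <= F (k + l) is the two-point inequality, and it also
   gives |P x - P y| <= P |x - y|. At a new dyadic point P satisfies the
   two-point inequality with equality, whence its maximality. The bounds
   2 F k <= k log2 k <= 2 F k + 2 k - 1 give
   x log2 (1 / x) <= P x <= x log2 (1 / x) + 2 x, hence a log-Lipschitz modulus
   and the cruder but subadditive modulus 6 sqrt |x - y|. With the latter P
   extends to a continuous function, which belongs to the family F_{1,1} and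
   dominates it by density of D; so it equals B_{1,1} on [0, 1]. *)

Require Import Defs.
From mathcomp Require Import all_boot all_order all_algebra.
From mathcomp Require Import all_classical all_reals all_analysis.
From mathcomp Require Import zify ring lra.
Set Implicit Arguments.
Unset Strict Implicit.
Import Order.TTheory GRing.Theory Num.Theory.
Import numFieldNormedType.Exports.
Local Open Scope classical_set_scope.
Local Open Scope ring_scope.

(** * Binary digit sums and superadditivity of [F] *)

Lemma s_widen (j n : nat) :
  (j <= n)%N -> s j = (\sum_(i < n) odd (j %/ 2 ^ i))%N.
Proof.
move=> jn; rewrite /s (big_ord_widen n (fun i => nat_of_bool (odd (j %/ 2 ^ i))))//.
rewrite big_mkcond; apply: eq_bigr => i _; case: ltnP => // ji.
by rewrite divn_small// (leq_ltn_trans ji)// ltn_expl.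
Qed.

(** [b] is the last binary digit of [b + j.*2], and the other digits are those of [j]. The
    recursions for [F] come from this. *)
Lemma s_shift (b : bool) (j : nat) : s (b + j.*2) = (b + s j)%N.
Proof.
rewrite (@s_widen (b + j.*2) (j.*2).+1) ?big_ord_recl; last by case: b.
rewrite expn0 divn1 oddD odd_double addbF oddb; congr addn.
rewrite (@s_widen j j.*2); last lia.
apply: eq_bigr => i _; rewrite lift0 expnS divnMA divn2.
by rewrite half_bit_double.
Qed.

Lemma F_recr (k : nat) : F k.+1 = (F k + s k)%N.
Proof. by rewrite /F big_ord_recr. Qed.

Lemma F0 : F 0 = 0%N. Proof. by rewrite /F big_ord0. Qed.

Lemma F1 : F 1 = 0%N. Proof. by rewrite F_recr F0 /s big_ord0. Qed.

Lemma F_double (k : nat) : F k.*2 = (2 * F k + k)%N.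
Proof.
elim: k => [|k IH]; first by rewrite F0.
rewrite doubleS !F_recr IH (s_shift false k) (s_shift true k) /=; lia.
Qed.

Lemma F_doubleS (k : nat) : F k.*2.+1 = (F k + F k.+1 + k)%N.
Proof. by rewrite !F_recr F_double (s_shift false k); lia. Qed.

(** Strong induction on [k + l]: [F_double] and [F_doubleS] reduce the claim to the halves [a] and
    [b]. Two odd arguments use the pairs [(a.+1, b)] and [(a, b.+1)]. *)
Lemma F_superadd (k l : nat) : (F k + F l + minn k l <= F (k + l))%N.
Proof.
move: {2}(k + l)%N (leqnn (k + l)) => n; elim/ltn_ind: n k l => n IH k l kln.
(* For positive [k] and [l] the halves have a sum below [k + l] even when one of them is rounded
   up. *)
have [->|k0] := posnP k; first by rewrite F0 !add0n min0n addn0.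
have [->|l0] := posnP l; first by rewrite F0 minn0 !addn0.
have {}IH a b : (a + b < k + l)%N -> (F a + F b + minn a b <= F (a + b))%N.
  by move=> ab; apply: (IH (a + b)%N) => //; exact: leq_trans kln.
rewrite -(odd_double_half k) -(odd_double_half l) in k0 l0 IH *.
move: k./2 l./2 k0 l0 IH => a b.
case: (odd k); case: (odd l); rewrite /= ?add0n ?add1n => k0 l0 IH.
- have -> : (a.*2.+1 + b.*2.+1 = (a + b).+1.*2)%N by lia.
  rewrite !F_double !F_doubleS.
  have [ab|ab] := posnP (a + b).
    have [-> ->] : a = 0%N /\ b = 0%N by lia.
    by rewrite addn0 F0 F1.
  have := IH a.+1 b; have := IH a b.+1; rewrite (addSn a) (addnS a); lia.
- have -> : (a.*2.+1 + b.*2 = (a + b).*2.+1)%N by lia.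
  rewrite F_double !F_doubleS.
  have := IH a.+1 b; have := IH a b; rewrite (addSn a); lia.
- have -> : (a.*2 + b.*2.+1 = (a + b).*2.+1)%N by lia.
  rewrite F_double !F_doubleS.
  have := IH a b.+1; have := IH a b; rewrite (addnS a); lia.
- rewrite -doubleD !F_double; have := IH a b; lia.
Qed.

(** The cases follow the recursion of [F]: in [F_doubleS] the odd argument draws on both [k] and
    [k.+1]. *)
Lemma double_ind (T : nat -> Prop) :
  T 1%N -> (forall k, (0 < k)%N -> T k -> T k.*2) ->
  (forall k, (0 < k)%N -> T k -> T k.+1 -> T k.*2.+1) ->
  forall k, (0 < k)%N -> T k.
Proof.
move=> T1 T2 T3; elim/ltn_ind => n IH n0.
have [->//|n1] := eqVneq n 1%N.
rewrite -(odd_double_half n); have := odd_double_half n.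
case: (odd n) => /= nE; rewrite ?add0n ?add1n.
- by apply: T3; [|apply: IH..]; lia.
- by apply: T2; [|apply: IH]; lia.
Qed.

(** * Comparison of [F k] with [k ln k] *)

Section FLog.
Variable R : realType.
Implicit Types x m : R.

Lemma ln_le_sub1 x : 0 < x -> ln x <= x - 1.
Proof.
move=> x0; have -> : x = 1 + (x - 1) by ring.
by rewrite (le_trans (le_ln1Dx _)); lra.
Qed.

Lemma ln2_gt0 : 0 < ln 2 :> R.
Proof. by apply: ln_gt0; lra. Qed.

Lemma ln2_ge : 1 / 2 <= ln 2 :> R.
Proof.
have := @ln_le_sub1 2^-1; rewrite lnV ?posrE ?invr_gt0//; lra.
Qed.

(** Both bounds are [ln_le_sub1], at [m / x] and at [x / m]. The lower bounds [x - m] cancel over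
    two points symmetric about [m]. *)
Lemma mul_ln_bounds x m : 0 < x -> 0 < m ->
  x - m <= x * (ln x - ln m) <= x * (x / m) - x.
Proof.
move=> x0 m0; apply/andP; split.
- have := @ln_le_sub1 (m / x); rewrite divr_gt0// ln_div ?posrE// => /(_ isT).
  rewrite -(ler_pM2l x0) [X in _ <= X]mulrBr mulr1 [x * (m / x)]mulrC divfK ?gt_eqF//; lra.
- have := @ln_le_sub1 (x / m); rewrite divr_gt0// ln_div ?posrE// => /(_ isT).
  by rewrite -(ler_pM2l x0) [X in _ <= X]mulrBr mulr1.
Qed.

(* Both bounds compare [ln k] and [ln (k + 1)] with [ln m] at the midpoint
   [m = k + 1/2]; the second-order terms sum to [1 / (2 m) <= ln 2]. *)
Lemma mul_ln_midpoint (k : nat) : (0 < k)%N ->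
  0 <= k%:R * ln (k%:R : R) + k.+1%:R * ln k.+1%:R
       - k.*2.+1%:R * (ln k.*2.+1%:R - ln 2) <= ln 2.
Proof.
move=> k0.
have k1 : 1 <= k%:R :> R by rewrite ler1n.
set x : R := k%:R in k1 *; set d := (X in 0 <= X).
have eS : k.+1%:R = x + 1 :> R by rewrite -natr1.
have eD : k.*2.+1%:R = 2 * x + 1 :> R by rewrite -natr1 -mul2n natrM.
pose m := x + 1 / 2.
have lm : ln k.*2.+1%:R - ln 2 = ln m.
  rewrite -ln_div ?posrE ?ltr0n// eD; congr ln; rewrite /m; lra.
have m0 : 0 < m by rewrite /m; lra.
have /andP[a1 a2] : x - m <= x * (ln x - ln m) <= x * (x / m) - x.
  by apply: mul_ln_bounds; lra.
have /andP[b1 b2] : x + 1 - m <= (x + 1) * (ln (x + 1) - ln m)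
    <= (x + 1) * ((x + 1) / m) - (x + 1) by apply: mul_ln_bounds; lra.
have dE : d = x * (ln x - ln m) + (x + 1) * (ln (x + 1) - ln m).
  by rewrite /d lm eS eD; ring.
have e : x * (x / m) - x + ((x + 1) * ((x + 1) / m) - (x + 1)) = (2 * m)^-1.
  by rewrite /m; field; apply: lt0r_neq0; lra.
have : (2 * m)^-1 <= 3^-1 by rewrite lef_pV2 ?posrE /m; lra.
have mE : x - m + (x + 1 - m) = 0 by rewrite /m; lra.
move=> m3; apply/andP; split; rewrite -/d dE; first lra.
by rewrite (le_trans (lerD a2 b2))// e; have := ln2_ge; lra.
Qed.

Lemma ln_double (k : nat) : (0 < k)%N -> ln k.*2%:R = ln 2 + ln k%:R :> R.
Proof. by move=> k0; rewrite -mul2n natrM lnM ?posrE ?ltr0n. Qed.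

(** The defect [k ln k - 2 F k ln 2] doubles from [k] to [k.*2]; by the upper midpoint bound, at
    [k.*2.+1] it is at least the sum of the defects at [k] and [k.+1]. *)
Lemma F_le_ln (k : nat) : 2 * (F k)%:R * ln 2 <= k%:R * ln k%:R :> R.
Proof.
have [->|] := posnP k; first by rewrite F0 !(mulr0, mul0r).
elim/double_ind: k / => [|k k0 IH|k k0 IH1 IH2].
- by rewrite F1 ln1 !(mulr0, mul0r).
- rewrite F_double ln_double // -mul2n natrD !natrM; move: IH; lra.
- have := mul_ln_midpoint k0 => /andP[_].
  rewrite F_doubleS !natrD -!natr1 -mul2n natrM in IH1 IH2 *; lra.
Qed.

(** The correction [2 k - 1] is fitted to the odd step: [(2 k - 1) + (2 k + 1)], plus [2 k + 1] from
    the lower midpoint bound, equals [2 (2 k + 1) - 1] plus twice the [k] of [F_doubleS]. *)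
Lemma F_ge_ln (k : nat) : (0 < k)%N ->
  k%:R * ln k%:R <= (2 * (F k)%:R + 2 * k%:R - 1) * ln 2 :> R.
Proof.
have l2 := ln2_gt0.
elim/double_ind: k / => [|k k0 IH|k k0 IH1 IH2].
- rewrite F1 ln1; lra.
- rewrite F_double ln_double // -mul2n natrD !natrM; lra.
- have := mul_ln_midpoint k0 => /andP[+ _].
  rewrite F_doubleS !natrD -!natr1 -mul2n natrM in IH1 IH2 *; lra.
Qed.

End FLog.

(** * The limit [P] on dyadic points *)

Section PonD.
Variable R : realType.
Implicit Types (x y t : R) (Q : R -> R).

Lemma B_dyadic (n k : nat) :
  B n (k%:R / 2 ^+ n : R) = (n%:R * k%:R - 2 * (F k)%:R) / 2 ^+ n.
Proof.
have n2 : 2 ^+ n != 0 :> R by rewrite expf_neq0.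
have e : 2 ^ (n%:Z - 1) = 2 ^+ n / 2 :> R by rewrite expfzDr.
by rewrite B_Dn e; field.
Qed.

Lemma dyadicD (n m k : nat) :
  (2 ^ m * k)%N%:R / 2 ^+ (m + n) = k%:R / 2 ^+ n :> R.
Proof.
have m2 : 2 ^+ m != 0 :> R by rewrite expf_neq0.
have n2 : 2 ^+ n != 0 :> R by rewrite expf_neq0.
by rewrite natrM natrX exprD; field; rewrite n2 m2.
Qed.

Lemma dyadic_double (n k : nat) : k.*2%:R / 2 ^+ n.+1 = k%:R / 2 ^+ n :> R.
Proof. by rewrite -(dyadicD n 1) expn1 mul2n. Qed.

Lemma dyadic_half (n k : nat) : k%:R / 2 ^+ n / 2 = k%:R / 2 ^+ n.+1 :> R.
Proof. by rewrite exprSr invfM mulrA. Qed.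

(** The summand [k] in [F_double] offsets the growth of the factor [n] to [n.+1]. *)
Lemma B_double (n k : nat) :
  B n.+1 (k%:R / 2 ^+ n : R) = B n (k%:R / 2 ^+ n : R).
Proof.
have n2 : 2 ^+ n != 0 :> R by rewrite expf_neq0.
rewrite -{1}dyadic_double !B_dyadic F_double -mul2n natrD !natrM -natr1 exprS.
by field.
Qed.

Lemma B_stationary (n m k : nat) :
  B (m + n) (k%:R / 2 ^+ n : R) = B n (k%:R / 2 ^+ n : R).
Proof. by elim: m => // m <-; rewrite addSn -(dyadicD n m) B_double. Qed.

Lemma B_cvg (n k : nat) :
  (fun m => B m (k%:R / 2 ^+ n : R)) @ \oo --> B n (k%:R / 2 ^+ n : R).
Proof.
(* The shift discards the indices [m] below [n], where the point may lie outside [Dn m]. *)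
rewrite -(cvg_shiftn n) /=.
by under eq_fun do rewrite B_stationary; exact: cvg_cst.
Qed.

Lemma P_dyadic (n k : nat) :
  P (k%:R / 2 ^+ n : R) = (n%:R * k%:R - 2 * (F k)%:R) / 2 ^+ n.
Proof. by rewrite -B_dyadic; apply/cvg_lim => //; exact: B_cvg. Qed.

Lemma D_dyadic (n k : nat) : (k <= 2 ^ n)%N -> D (k%:R / 2 ^+ n : R).
Proof. by move=> kn; exists n => //; exists k. Qed.

Lemma D_exists x : D x -> exists n k, (k <= 2 ^ n)%N /\ x = k%:R / 2 ^+ n.
Proof. by case=> n _ [k kn ->]; exists n, k. Qed.

Lemma D_common x y : D x -> D y -> exists n k l,
  [/\ (k <= 2 ^ n)%N, (l <= 2 ^ n)%N, x = k%:R / 2 ^+ n & y = l%:R / 2 ^+ n].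
Proof.
move=> [n _ [k kn ->]] [m _ [l lm ->]].
exists (m + n)%N, (2 ^ m * k)%N, (2 ^ n * l)%N.
split; rewrite ?dyadicD//; last by rewrite addnC dyadicD.
- by rewrite expnD leq_mul2l kn orbT.
- by rewrite addnC expnD leq_mul2l lm orbT.
Qed.

Lemma D_itv x : D x -> 0 <= x <= 1.
Proof.
move=> /D_exists[n [k [kn ->]]].
by rewrite divr_ge0 ?exprn_ge0//= ler_pdivrMr ?exprn_gt0// mul1r -natrX ler_nat.
Qed.

Lemma D_0 : D (0 : R).
Proof. by rewrite -(mul0r (2 ^+ 0)^-1); exact: (@D_dyadic 0 0). Qed.

Lemma D_1 : D (1 : R).
Proof. by rewrite -(divr1 1) -[X in _ / X](expr0 2); exact: (@D_dyadic 0 1). Qed.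

Lemma P_0 : P (0 : R) = 0.
Proof. have := P_dyadic 0 0; rewrite F0 expr0 !divr1 mulr0n; lra. Qed.

Lemma P_1 : P (1 : R) = 0.
Proof. have := P_dyadic 0 1; rewrite F1 expr0 !divr1 mulr0n mulr1n; lra. Qed.

Lemma D_onem x : D x -> D (1 - x).
Proof.
move=> /D_exists[n [k [kn ->]]].
have -> : 1 - k%:R / 2 ^+ n = (2 ^ n - k)%N%:R / 2 ^+ n :> R.
  by rewrite natrB// natrX mulrBl divff// expf_neq0.
by apply: D_dyadic; exact: leq_subr.
Qed.

Lemma D_half x : D x -> D (x / 2).
Proof.
move=> /D_exists[n [k [kn ->]]].
rewrite dyadic_half.
by apply: D_dyadic; rewrite (leq_trans kn)// leq_exp2l.
Qed.

Lemma P_half x : D x -> P x + x = 2 * P (x / 2).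
Proof.
move=> /D_exists[n [k [kn ->]]].
have n2 : 2 ^+ n != 0 :> R by rewrite expf_neq0.
by rewrite dyadic_half !P_dyadic -natr1 exprS; field.
Qed.

(** By [F_doubleS], neighbours in [Dn n] give equality in the two-point inequality. Nonnegativity
    and maximality of [P] rest on this. *)
Lemma P_mid (n j : nat) :
  P (j.*2.+1%:R / 2 ^+ n.+1 : R) =
  (P (j%:R / 2 ^+ n : R) + P (j.+1%:R / 2 ^+ n : R)) / 2 + 1 / 2 ^+ n.+1.
Proof.
have n2 : 2 ^+ n != 0 :> R by rewrite expf_neq0.
rewrite !P_dyadic F_doubleS !natrD -!natr1 -mul2n natrM exprS.
by field.
Qed.

(** Induction on the level: a point of [Dn n.+1] lies in [Dn n] or is the midpoint of two neighbours
    there. *)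
Lemma dyadic_ind (T : R -> Prop) :
  T 0 -> T 1 ->
  (forall n j, (j < 2 ^ n)%N -> T (j%:R / 2 ^+ n) -> T (j.+1%:R / 2 ^+ n) ->
     T (j.*2.+1%:R / 2 ^+ n.+1)) ->
  forall x, D x -> T x.
Proof.
move=> T0 T1 TS x /D_exists[n [k [kn ->]]].
elim: n k kn => [|n IH] k kn.
  by rewrite expr0 divr1; move: kn; rewrite expn0; case: k => [|[|]].
rewrite -(odd_double_half k) expnS in kn *.
case: (odd k) kn => /=; rewrite ?add0n ?add1n => kn.
- by apply: TS; [lia|apply: IH; lia..].
- by rewrite dyadic_double; apply: IH; lia.
Qed.

Lemma P_ge0 x : D x -> 0 <= P x.
Proof.
move: x; apply: dyadic_ind => [||n j _ Pj PSj]; rewrite ?P_0 ?P_1// P_mid.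
by rewrite addr_ge0// divr_ge0 ?addr_ge0 ?exprn_ge0.
Qed.

Lemma P_maximal Q x : admissible_on_D Q -> D x -> Q x <= P x.
Proof.
move=> [_ Q0 Q1 Q2]; move: x.
apply: dyadic_ind => [||n j jn Qj QSj]; rewrite ?P_0 ?P_1 ?Q0 ?Q1// P_mid.
have n0 : 0 < 2 ^+ n :> R by rewrite exprn_gt0.
have := Q2 _ _ (D_dyadic (ltnW jn)) (D_dyadic jn).
have -> : (j%:R / 2 ^+ n + j.+1%:R / 2 ^+ n) / 2 = j.*2.+1%:R / 2 ^+ n.+1 :> R.
  by rewrite -!natr1 -mul2n natrM exprS; field; exact: lt0r_neq0.
have -> : (j%:R / 2 ^+ n - j.+1%:R / 2 ^+ n) / 2 = - (1 / 2 ^+ n.+1) :> R.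
  by rewrite -!natr1 exprS; field; exact: lt0r_neq0.
rewrite normrN ger0_norm ?divr_ge0 ?exprn_ge0//; lra.
Qed.

Lemma P_two_point : two_point_inequality D (P : R -> R).
Proof.
move=> x y Dx Dy; wlog xy : x y Dx Dy / x <= y.
  have [xy|/ltW yx] := leP x y; first by apply.
  by rewrite [x + y]addrC [P x + _]addrC -normrN -mulNr opprB; apply.
have [n [k [l [_ _ xE yE]]]] := D_common Dx Dy.
have n0 : 0 < 2 ^+ n :> R by rewrite exprn_gt0.
have kl : (k <= l)%N.
  by move: xy; rewrite xE yE ler_pM2r ?invr_gt0// ler_nat.
rewrite ler0_norm; last lra.
have -> : (x + y) / 2 = (k + l)%N%:R / 2 ^+ n.+1.
  by rewrite xE yE natrD exprS; field; exact: lt0r_neq0.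
rewrite xE yE !P_dyadic -subr_ge0.
set r := (X in 0 <= X).
(* The terms with factor [n] cancel, and what remains is the slack of [F_superadd]. *)
have -> : r = ((F (k + l))%:R - (F k + F l + minn k l)%N%:R) / 2 ^+ n.
  rewrite (minn_idPl kl) /r -natr1 !natrD exprS; field.
  exact: lt0r_neq0.
by apply: divr_ge0; rewrite ?(ltW n0)// subr_ge0 ler_nat F_superadd.
Qed.

Lemma P_admissible : admissible_on_D (P : R -> R).
Proof. by split; [exact: P_ge0|exact: P_0|exact: P_1|exact: P_two_point]. Qed.

(* By maximality: [x |-> P (1 - x)] is admissible, too. *)
Lemma P_onem x : D x -> P x = P (1 - x).
Proof.
have adm : admissible_on_D (fun x : R => P (1 - x)).
  split=> [t Dt|||t u Dt Du].
  - exact/P_ge0/D_onem.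
  - by rewrite subr0 P_1.
  - by rewrite subrr P_0.
  - have := P_two_point (D_onem Dt) (D_onem Du).
    have -> : (1 - t + (1 - u)) / 2 = 1 - (t + u) / 2 by lra.
    have -> : (1 - t - (1 - u)) / 2 = - ((t - u) / 2) by lra.
    by rewrite normrN.
move=> Dx; apply/eqP; rewrite eq_le (P_maximal adm)// andbT.
by have := P_maximal adm (D_onem Dx); rewrite opprB addrC subrK.
Qed.

(** Superadditivity of [F] bounds the increments of [P], and the symmetry [P_onem] its decrements.
    Any bound on [P] near 0 thus becomes a modulus of continuity. *)
Lemma P_diff x y : D x -> D y -> D `|x - y| /\ `|P x - P y| <= P `|x - y|.
Proof.
move=> Dx Dy.
have inc (u v : R) : D u -> D v -> u <= v -> D (v - u) /\ P v - P u <= P (v - u).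
  move=> Du Dv uv; have [n [k [l [_ ln uE vE]]]] := D_common Du Dv.
  have n0 : 0 < 2 ^+ n :> R by rewrite exprn_gt0.
  have kl : (k <= l)%N.
    by move: uv; rewrite uE vE ler_pM2r ?invr_gt0// ler_nat.
  have -> : v - u = (l - k)%N%:R / 2 ^+ n by rewrite natrB// uE vE mulrBl.
  split; first by apply: D_dyadic; lia.
  rewrite uE vE !P_dyadic -mulrBl ler_pM2r ?invr_gt0//.
  have := F_superadd k (l - k); rewrite subnKC// natrB// => Fkl.
  have : ((F k)%:R + (F (l - k))%:R <= (F l)%:R :> R)%R.
    by rewrite -natrD ler_nat; lia.
  lra.
wlog xy : x y Dx Dy / x <= y.
  have [xy|/ltW yx] := leP x y; first by apply.
  by rewrite distrC [`|P _ - _|]distrC; apply.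
rewrite distrC [`|P _ - _|]distrC ger0_norm ?subr_ge0//.
have [Dyx Pyx] := inc _ _ Dx Dy xy; split => //.
(* Reflection turns a decrease from [x] to [y] into an increase over an interval of the same
   length. *)
rewrite ler_norml Pyx andbT lerNl opprB (P_onem Dx) (P_onem Dy).
have -> : y - x = 1 - x - (1 - y) by lra.
by apply: (inc _ _ (D_onem Dy) (D_onem Dx) _).2; lra.
Qed.

(** * Entropy bounds for [P] on [D] *)

Lemma log2V x : 0 < x -> log2 (1 / x) = - (ln x / ln 2).
Proof. by move=> x0; rewrite /log2 div1r lnV ?posrE// mulNr. Qed.

Lemma ln_dyadic (n k : nat) : (0 < k)%N ->
  ln (k%:R / 2 ^+ n) = ln k%:R - n%:R * ln 2 :> R.
Proof.
by move=> k0; rewrite ln_div ?posrE ?exprn_gt0 ?ltr0n// lnXn// mulr_natl.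
Qed.

(** For [x = k / 2 ^ n] the terms [n k] cancel against those of [P], leaving [F_le_ln] and
    [F_ge_ln]. *)
Lemma P_entropy x : D x ->
  x * log2 (1 / x) <= P x <= x * log2 (1 / x) + 2 * x.
Proof.
move=> Dx; have [n [k [_ xE]]] := D_exists Dx.
have [k0|k0] := posnP k.
  by rewrite xE k0 !mul0r P_0 mulr0 addr0 lexx.
have n0 : 0 < 2 ^+ n :> R by rewrite exprn_gt0.
have l2 := ln2_gt0 R.
have x0 : 0 < x by rewrite xE divr_gt0 ?ltr0n.
rewrite log2V// {3 4}xE P_dyadic.
have -> : x * - (ln x / ln 2) = (n%:R * k%:R - k%:R * ln k%:R / ln 2) / 2 ^+ n.
  rewrite {2}xE ln_dyadic// xE; field.
  by rewrite !lt0r_neq0.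
have -> : 2 * x = 2 * k%:R / 2 ^+ n by rewrite xE mulrA.
rewrite -mulrDl !ler_pM2r ?invr_gt0//.
have h1 : 2 * (F k)%:R <= k%:R * ln k%:R / ln 2 :> R.
  by rewrite ler_pdivlMr// F_le_ln.
have h2 : k%:R * ln k%:R / ln 2 <= 2 * (F k)%:R + 2 * k%:R - 1 :> R.
  by rewrite ler_pdivrMr// F_ge_ln.
by apply/andP; split; lra.
Qed.

Lemma P_le_log x : D x -> x < 1 / 2 -> P x <= 3 / ln 2 * x * ln (1 / x).
Proof.
move=> Dx x2; have /andP[x0 _] := D_itv Dx; have l2 := ln2_gt0 R.
have [<-|xn0] := eqVneq 0 x; first by rewrite P_0 mulr0 mul0r.
have {x0} xp : 0 < x by rewrite lt_neqAle xn0.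
have /andP[_ /le_trans] := P_entropy Dx; apply.
have -> : 3 / ln 2 * x * ln (1 / x) = x * (3 * log2 (1 / x)).
  by rewrite /log2; ring.
rewrite [2 * x]mulrC -mulrDr ler_pM2l//.
(* The constant 3 is [1 + 2]: below [1 / 2] the error [2 x] is at most [2 x log2 (1 / x)]. *)
suff : 1 <= log2 (1 / x) by lra.
rewrite /log2 ler_pdivlMr// [1 * ln 2]mul1r ler_ln ?posrE ?divr_gt0//.
rewrite ler_pdivlMr//; lra.
Qed.

(** The constant 6 is [4 + 2]. With [r] the root of [x], the entropy term is
    [2 r (r ln (1 / r)) / ln 2], at most [4 r] as [r ln (1 / r) <= 1] and [ln 2 >= 1 / 2]; moreover
    [2 x <= 2 r]. *)
Lemma P_le_sqrt x : D x -> P x <= 6 * Num.sqrt x.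
Proof.
move=> Dx; have /andP[x0 x1] := D_itv Dx; have l2 := ln2_ge R.
have [<-|xn0] := eqVneq 0 x; first by rewrite P_0 sqrtr0 mulr0.
have {x0} xp : 0 < x by rewrite lt_neqAle xn0.
have /andP[_ /le_trans] := P_entropy Dx; apply.
set r := Num.sqrt x.
have r0 : 0 < r by rewrite sqrtr_gt0.
have xE : x = r ^+ 2 by rewrite sqr_sqrtr// ltW.
have r1 : r <= 1 by rewrite -(sqrtr1 R) ler_wsqrtr.
have h : r * ln (1 / r) <= 1.
  rewrite mulrC -ler_pdivlMr// (le_trans (@ln_le_sub1 _ (1 / r) _))//.
    by rewrite divr_gt0.
  by rewrite gerBl.
have h0 : 0 <= ln (1 / r) by rewrite ln_ge0// ler_pdivlMr// mul1r.
have lE : ln (1 / x) = 2 * ln (1 / r).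
  by rewrite xE !div1r -exprVn lnXn ?invr_gt0// mulr_natl.
have -> : x * log2 (1 / x) = 2 * r * (r * ln (1 / r)) / ln 2.
  by rewrite /log2 lE xE; ring.
have : 2 * r * (r * ln (1 / r)) / ln 2 <= 4 * r.
  rewrite ler_pdivrMr ?ln2_gt0//.
  have : 2 * r * (r * ln (1 / r)) <= 2 * r by rewrite ler_piMr// mulr_ge0// ltW.
  have : r * (1 / 2) <= r * ln 2 by rewrite ler_pM2l.
  lra.
have : r ^+ 2 <= r by rewrite expr2 ler_piMr// ltW.
rewrite -xE; lra.
Qed.

End PonD.

(** * Extension from [D] and passage to limits along [D] *)

Section Extension.
Variable R : realType.
Implicit Types (x y t : R) (f g : R -> R) (S : set R).

Lemma sqrt_dist x y z :
  Num.sqrt `|x - z| <= Num.sqrt `|x - y| + Num.sqrt `|y - z|.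
Proof.
rewrite -(@ler_pXn2r _ 2) ?nnegrE ?addr_ge0 ?sqrtr_ge0//.
rewrite sqrrD !sqr_sqrtr ?normr_ge0// addrAC.
rewrite (le_trans (ler_distD y x z))// lerDl mulrn_wge0// mulr_ge0 ?sqrtr_ge0//.
Qed.

(* McShane extension: the modulus [c * sqrt] is subadditive. *)
Lemma sqrt_extension (A : set R) f c : 0 <= c -> A !=set0 ->
  (forall x y, A x -> A y -> `|f x - f y| <= c * Num.sqrt `|x - y|) ->
  exists g, (forall x y, `|g x - g y| <= c * Num.sqrt `|x - y|) /\
            (forall x, A x -> g x = f x).
Proof.
move=> c0 [a Aa] fc.
have tri x y z : c * Num.sqrt `|x - z| <=
    c * Num.sqrt `|x - y| + c * Num.sqrt `|y - z|.
  by rewrite -mulrDr ler_wpM2l// sqrt_dist.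
pose V t := [set f d - c * Num.sqrt `|t - d| | d in A].
have Vne t : V t !=set0 by exists (f a - c * Num.sqrt `|t - a|), a.
have Vub t : has_ubound (V t).
  exists (f a + c * Num.sqrt `|t - a|) => _ [d Ad <-].
  have := fc _ _ Ad Aa; have := tri d t a.
  by rewrite (distrC d t) => ?; move/(le_trans (ler_norm _)); lra.
exists (fun t => sup (V t)); split=> [x y|x Ax].
- have half t u : sup (V t) <= sup (V u) + c * Num.sqrt `|t - u|.
    apply: ge_sup => // _ [d Ad <-].
    have : f d - c * Num.sqrt `|u - d| <= sup (V u).
      by apply: ub_le_sup => //; exists d.
    by have := tri u t d; rewrite (distrC u t); lra.
  by have := half x y; have := half y x; rewrite (distrC y x) ler_distl; lra.
- apply/eqP; rewrite eq_le; apply/andP; split.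
  + apply: ge_sup => // _ [d Ad <-].
    by have := le_trans (ler_norm _) (fc _ _ Ad Ax); rewrite distrC; lra.
  + apply: ub_le_sup => //; exists x => //.
    by rewrite subrr normr0 sqrtr0 mulr0 subr0.
Qed.

Lemma sqrt_modulus_continuous g c : 0 <= c ->
  (forall x y, `|g x - g y| <= c * Num.sqrt `|x - y|) -> continuous g.
Proof.
move=> c0 gc x; apply/cvgrPdist_le => e e0.
(* Dividing by [c + 1] rather than [c] covers the case [c = 0]. *)
have c1 : 0 < c + 1 by lra.
have d0 : 0 < (e / (c + 1)) ^+ 2 by rewrite exprn_gt0// divr_gt0.
near=> y; rewrite (le_trans (gc x y))//.
have : Num.sqrt `|x - y| <= e / (c + 1).
  rewrite -[leRHS]ger0_norm ?divr_ge0 ?(ltW e0) ?(ltW c1)// -(sqrtr_sqr (e / _)).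
  by rewrite ler_wsqrtr//; near: y; exact: cvgr_dist_le.
move=> /(ler_wpM2l c0)/le_trans; apply.
by rewrite mulrCA ler_piMr ?(ltW e0)// ler_pdivrMr//; lra.
Unshelve. all: by end_near. Qed.

Lemma closure_D x : x \in `[0, 1] -> closure D x.
Proof.
rewrite in_itv /= => /andP[x0 x1] U /nbhs_ballP[e /= e0 xeU].
(* This [n] makes the mesh [1 / 2 ^ n] smaller than [e]; rounding [2 ^ n * x] down gives the dyadic
   point. *)
pose n := (Num.truncn e^-1).+1.
have en : e^-1 < 2 ^+ n.
  by rewrite (lt_trans (truncnS_gt _))// -natrX ltr_nat ltn_expl.
have n0 : 0 < 2 ^+ n :> R by rewrite exprn_gt0.
have m0 : 0 <= 2 ^+ n * x by rewrite mulr_ge0// ltW.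
have /andP[k1 k2] := truncn_itv m0.
exists ((Num.truncn (2 ^+ n * x))%:R / 2 ^+ n); split.
  apply: D_dyadic; rewrite -(ler_nat R) (le_trans k1)// natrX.
  by rewrite ler_piMr// ltW.
apply: xeU; rewrite /ball /= ger0_norm; last first.
  by rewrite subr_ge0 ler_pdivrMr// [x * _]mulrC.
have : (2 ^+ n)^-1 < e by rewrite invf_plt.
apply: le_lt_trans; rewrite lerBlDr -[X in X + _]mul1r -mulrDl.
by rewrite ler_pdivlMr// mulrC nat1r ltW.
Qed.

Lemma D_sub_itv : D `<=` ([set` `[0, 1]] : set R).
Proof. by move=> x /D_itv; rewrite /= in_itv. Qed.

(** Convergence is asked along [D] only, since members of [F11] are continuous merely within
    [[0, 1]]. The comparison is local, to allow for the condition [|x - y| < 1 / 2]. *)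
Lemma le_from_D x f g : x \in `[0, 1] ->
  f @ within D (nbhs x) --> f x -> g @ within D (nbhs x) --> g x ->
  (\forall z \near x, D z -> f z <= g z) -> f x <= g x.
Proof.
move=> x01 fx gx fg.
have PF : ProperFilter (within D (nbhs x)).
  by apply: within_nbhs_proper; exact: closure_D.
exact: (ler_cvg_to fx gx).
Qed.

Lemma le_from_D_continuous x f g : x \in `[0, 1] ->
  f @ x --> f x -> g @ x --> g x ->
  (forall z, D z -> f z <= g z) -> f x <= g x.
Proof.
move=> x01 fx gx fg; apply: le_from_D => //; first exact: cvg_within_filter.
- exact: cvg_within_filter.
- by near=> z; exact: fg.
Unshelve. all: by end_near. Qed.

Lemma eq_from_D_continuous x f g : x \in `[0, 1] ->
  f @ x --> f x -> g @ x --> g x ->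
  (forall z, D z -> f z = g z) -> f x = g x.
Proof.
move=> x01 fx gx fg; apply/eqP; rewrite eq_le; apply/andP.
by split; apply: le_from_D_continuous => // z /fg ->.
Qed.

Lemma cvg_compose (T : Type) (F : set_system T) {FF : Filter F}
    (h : R -> R) (u : T -> R) (a : R) :
  h @ a --> h a -> u @ F --> a -> (fun z => h (u z)) @ F --> h a.
Proof. by move=> ha ua; apply: continuous_cvg. Qed.

Lemma entropy_continuous x : 0 < x ->
  (fun z : R => z * ln (1 / z)) @ x --> x * ln (1 / x).
Proof.
move=> x0.
have inv : (fun z : R => 1 / z) @ x --> 1 / x.
  by apply: cvgM; [exact: cvg_cst|apply: cvgV; [exact: lt0r_neq0|exact: cvg_id]].
have lncvg : (fun z : R => ln (1 / z)) @ x --> ln (1 / x).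
  by apply: (cvg_compose _ inv); apply: continuous_ln; rewrite divr_gt0.
by apply: (cvgM _ lncvg); exact: cvg_id.
Qed.

(* Applying this lemma twice passes from [D] to [0, 1] in both variables. *)
Lemma log_Lipschitz_from_D g (C : R) y : continuous g ->
  (forall x, D x -> `|x - y| < 1 / 2 ->
     `|g x - g y| <= C * `|x - y| * ln (1 / `|x - y|)) ->
  forall x, x \in `[0, 1] -> `|x - y| < 1 / 2 ->
     `|g x - g y| <= C * `|x - y| * ln (1 / `|x - y|).
Proof.
move=> gC gD x x01 xy; have [->|xny] := eqVneq x y.
  by rewrite !subrr !normr0 mulr0 mul0r.
have dist_cvg : `|z - y| @[z --> x] --> `|x - y|.
  by apply: cvg_norm; apply: cvgB; [exact: cvg_id|exact: cvg_cst].
apply: (@le_from_D x (fun z => `|g z - g y|)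
  (fun z => C * `|z - y| * ln (1 / `|z - y|))) => //.
- apply: cvg_within_filter; apply: cvg_norm.
  by apply: cvgB; [exact: gC|exact: cvg_cst].
- apply: cvg_within_filter; under eq_fun do rewrite -mulrA.
  rewrite -mulrA; apply: cvgM; first exact: cvg_cst.
  apply: (@cvg_compose _ _ _ (fun r : R => r * ln (1 / r))) => //.
  by apply: entropy_continuous; rewrite normr_gt0 subr_eq0.
- near=> z => Dz; apply: gD => //; near: z.
  exact: (cvgr_lt _ dist_cvg).
Unshelve. all: by end_near. Qed.

(** With [y] fixed only one variable moves; a second use, after exchanging the variables, treats the
    other. *)
Lemma two_point_from_D g y : continuous g ->
  (forall x, D x -> g ((x + y) / 2) <= (g x + g y) / 2 + `|(x - y) / 2|) ->
  forall x, x \in `[0, 1] ->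
    g ((x + y) / 2) <= (g x + g y) / 2 + `|(x - y) / 2|.
Proof.
move=> gC gD x x01.
apply: (@le_from_D_continuous x (fun z => g ((z + y) / 2))
  (fun z => (g z + g y) / 2 + `|(z - y) / 2|)) => //.
- apply: (@cvg_compose _ _ _ g); first exact: gC.
  by apply: cvgM; [apply: cvgD; [exact: cvg_id|exact: cvg_cst]|exact: cvg_cst].
- apply: cvgD; first by
    apply: cvgM; [apply: cvgD; [exact: gC|exact: cvg_cst]|exact: cvg_cst].
  apply: cvg_norm.
  by apply: cvgM; [apply: cvgB; [exact: cvg_id|exact: cvg_cst]|exact: cvg_cst].
Qed.

Lemma star_onem x : star (1 - x) = star x.
Proof. by rewrite /star subKr minC. Qed.

(** Serves both [P] on [D] and [B11] on [[0, 1]]: symmetry replaces [x] by [star x], and the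
    equality points reduce to [2 ^- k], where [f] is [P]. *)
Lemma entropy_boundP S f :
  (forall x, S x -> S (1 - x) /\ f x = f (1 - x)) ->
  (forall x, S x -> x * log2 (1 / x) <= f x) ->
  (forall x, D x -> S x /\ f x = P x) ->
  entropy_bound S f.
Proof.
move=> fS fE fP; split=> [x Sx|k x xE].
  have [S1x f1x] := fS _ Sx; rewrite /star minEle; case: ifP => _; first exact: fE.
  by rewrite f1x; exact: fE.
have kk : (2 ^- k : R) = 1%:R / 2 ^+ k by rewrite div1r.
have D2k : D (2 ^- k : R) by rewrite kk; apply: D_dyadic; rewrite expn_gt0.
have -> : f x = f (2 ^- k).
  by case: xE => ->//; rewrite -(fS _ (fP _ D2k).1).2.
have -> : star x = star (2 ^- k) by case: xE => ->//; rewrite star_onem.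
rewrite (fP _ D2k).2 kk P_dyadic F1 mulr0 subr0 mulr1.
(* At [k = 0] the point is 1 and both sides vanish. Otherwise [star] fixes [2 ^- k], and both sides
   equal [k / 2 ^ k] because [F 1 = 0]. *)
case: k {kk D2k xE} => [|k].
  have s1 : star (1 : R) = 0 by rewrite /star subrr min_r.
  by rewrite expr0 !divr1 s1 !mul0r.
have k0 : 0 < 2 ^+ k.+1 :> R by rewrite exprn_gt0.
have -> : star (1 / 2 ^+ k.+1 : R) = 1 / 2 ^+ k.+1.
  have h : 1 / 2 ^+ k.+1 <= 1 / 2 :> R.
    by rewrite !div1r lef_pV2 ?posrE// -[leLHS]expr1 ler_eXn2l ?ltr1n.
  by rewrite /star min_l//; lra.
rewrite log2V ?divr_gt0// (@ln_dyadic R k.+1 1)// ln1 sub0r mulNr opprK.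
by rewrite mulfK ?lt0r_neq0 ?ln2_gt0// mulrC mul1r.
Qed.

End Extension.

(** * Identification of [B11] with the extension of [P] *)

Section Maximal.
Variable R : realType.

Lemma P_sqrt_modulus (x y : R) : D x -> D y ->
  `|P x - P y| <= 6 * Num.sqrt `|x - y|.
Proof.
move=> Dx Dy; have [Dxy] := P_diff Dx Dy.
by move=> /le_trans; apply; exact: P_le_sqrt.
Qed.

Lemma P_log_Lipschitz (x y : R) : D x -> D y -> `|x - y| < 1 / 2 ->
  `|P x - P y| <= 3 / ln 2 * `|x - y| * ln (1 / `|x - y|).
Proof.
move=> Dx Dy xy; have [Dxy] := P_diff Dx Dy.
by move=> /le_trans; apply; exact: P_le_log.
Qed.

Lemma B11_continuous_extension : exists g : R -> R,
  [/\ continuous g, forall x, D x -> g x = P x &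
      forall x, x \in `[0, 1] -> B11 x = g x].
Proof.
have [g [gc gP]] := sqrt_extension (ler0n R 6) (ex_intro _ 0 (@D_0 R)) P_sqrt_modulus.
have gC : continuous g by apply: sqrt_modulus_continuous gc; lra.
exists g; split => // t t01.
have gF11 : F11 g.
  split.
  - exact: continuous_subspaceT.
  - move=> x x01; apply: (@le_from_D_continuous R x (fun=> 0)) => //.
    + exact: cvg_cst.
    + exact: gC.
    + by move=> z Dz; rewrite gP// P_ge0.
  - by rewrite gP ?P_0//; exact: D_0.
  - by rewrite gP ?P_1//; exact: D_1.
  - move=> x y x01 y01; apply: two_point_from_D => // {x01} x Dx.
    rewrite addrC [g x + _]addrC -normrN -mulNr opprB.
    apply: two_point_from_D => // {y01} y Dy.
    rewrite !gP//; first exact: P_two_point.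
    have [n [k [l [kn ln -> ->]]]] := D_common Dx Dy.
    rewrite -mulrDl -natrD dyadic_half; apply: D_dyadic.
    by rewrite expnS mul2n -addnn addnC leq_add.
(* On [D] a member of [F11] is admissible, hence at most [P]; its continuity within [[0, 1]] carries
   the bound to [t]. *)
have F11_le f : F11 f -> f t <= g t.
  move=> [fC f0 f00 f10 f2].
  apply: le_from_D => //; last first.
  - near=> z => Dz; rewrite gP//; apply: P_maximal => //; split => //.
    + by move=> x Dx; apply: f0; exact: D_sub_itv.
    + by move=> x y Dx Dy; apply: f2; exact: D_sub_itv.
  - by apply: cvg_within_filter; exact: gC.
  - have /subspace_continuousP/(_ t t01) := fC.
    apply: cvg_trans; apply: cvg_app; apply: within_subset.
    exact: D_sub_itv.
apply/eqP; rewrite eq_le; apply/andP; split.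
- apply: ge_sup => [|_ [f fF <-]]; last exact: F11_le.
  by exists (g t), g.
- by apply: ub_le_sup; [exact: (F11_has_sup t01).2|exists g].
Unshelve. all: by end_near. Qed.

End Maximal.

Unset Implicit Arguments.

Theorem theorem1p9 (R : realType) :
  (* (i) *)
  (forall x : R, D x -> cvgn (fun n => B n x)) /\
  (* (ii) *)
  (admissible_on_D (P : R -> R) /\
   forall Q : R -> R, admissible_on_D Q -> forall x, D x -> Q x <= P x) /\
  (* (iii) *)
  log_Lipschitz D (P : R -> R) /\
  (* (iv) *)
  functional_equations D (P : R -> R) /\
  (* (v) *)
  entropy_bound D (P : R -> R) /\
  (* (vi) *)
  ((forall x : R, D x -> B11 x = P x) /\
   log_Lipschitz `[0, 1] (B11 : R -> R) /\
   functional_equations `[0, 1] (B11 : R -> R) /\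
   entropy_bound `[0, 1] (B11 : R -> R)).
Proof.
have C0 : 0 < 3 / ln 2 :> R by rewrite divr_gt0// ln2_gt0.
(* Limits are taken with [g], continuous on the whole line and equal to [B11] on [[0, 1]]. *)
have [g [gC gP gB]] := B11_continuous_extension R.
have itv1 (x : R) : x \in `[0, 1] -> 1 - x \in `[0, 1].
  by rewrite !in_itv /= => /andP[? ?]; apply/andP; split; lra.
have itv2 (x : R) : x \in `[0, 1] -> x / 2 \in `[0, 1].
  by rewrite !in_itv /= => /andP[? ?]; apply/andP; split; lra.
have g_onem (x : R) : x \in `[0, 1] -> g x = g (1 - x).
  move=> x01; apply: (@eq_from_D_continuous R x g (fun z => g (1 - z))) => //.
  - exact: gC.
  - apply: (@cvg_compose _ _ _ _ g); first exact: gC.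
    by apply: cvgB; [exact: cvg_cst|exact: cvg_id].
  - by move=> z Dz; rewrite !gP//; [exact: P_onem|exact: D_onem].
have B11P (x : R) : D x -> B11 x = P x.
  by move=> Dx; rewrite gB ?gP//; exact: D_sub_itv.
refine (conj _ (conj (conj _ _) (conj _ (conj _ (conj _
  (conj _ (conj _ (conj _ _)))))))).
- move=> x /D_exists[n [k [_ ->]]].
  by apply/cvg_ex; exists (B n (k%:R / 2 ^+ n)); exact: B_cvg.
- exact: P_admissible.
- by move=> Q Qadm x Dx; exact: P_maximal.
- by exists (3 / ln 2) => // x y; exact: P_log_Lipschitz.
- by move=> x Dx; split; [exact: P_onem|exact: P_half].
- apply: entropy_boundP => // x Dx.
  + by split; [exact: D_onem|exact: P_onem].
  + by have /andP[] := P_entropy Dx.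
- exact: B11P.
- exists (3 / ln 2) => // x y x01 y01 xy; rewrite !gB//.
  apply: log_Lipschitz_from_D => // {x01 xy} x Dx xy.
  rewrite (distrC (g x)); rewrite (distrC x) in xy *.
  apply: log_Lipschitz_from_D => // {y01 xy} y Dy xy.
  by rewrite !gP//; exact: P_log_Lipschitz.
- move=> x x01; rewrite !gB ?itv1 ?itv2//; split; first exact: g_onem.
  apply: (@eq_from_D_continuous R x (fun z => g z + z) (fun z => 2 * g (z / 2))) => //.
  + by apply: cvgD; [exact: gC|exact: cvg_id].
  + apply: cvgM; first exact: cvg_cst.
    apply: (@cvg_compose _ _ _ _ g); first exact: gC.
    by apply: cvgM; [exact: cvg_id|exact: cvg_cst].
  + by move=> z Dz; rewrite !gP//; [exact: P_half|exact: D_half].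
- apply: entropy_boundP => x x01.
  + by rewrite !gB ?itv1//; split; [exact: itv1|exact: g_onem].
  (* [entropy_continuous] needs a positive point; at 0 the bound is [0 <= P 0]. *)
  + rewrite gB//; have [<-|xn0] := eqVneq 0 x.
      by rewrite mul0r gP ?P_0//; exact: D_0.
    have x0 : 0 < x by move: x01; rewrite /= in_itv /= lt_neqAle xn0 => /andP[].
    rewrite /log2 mulrA; apply: (@le_from_D_continuous R x
      (fun z => z * ln (1 / z) / ln 2) g) => //.
    * by apply: cvgM; [exact: entropy_continuous|exact: cvg_cst].
    * exact: gC.
    * by move=> z Dz; rewrite gP// -mulrA; have /andP[] := P_entropy Dz.
  + by split; [exact: D_sub_itv|exact: B11P].
Qed.
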